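(* Let the form $F$ be strongly pseudoconvex. Then $F$ is T-nondegenerate, hence $\mathfrak g_3=0$.
   Context: $F=(F_1,\dots,F_k)$ is a $\mathbb C^k$-valued Hermitian form on $\mathbb C^m$: $F_j(a,b)=\langle A_ja,b\rangle$, $\langle a,b\rangle=\sum_l a_l\bar b_l$, with $A_1,\dots,A_k$ Hermitian $m\times m$ matrices. $F$ is nondegenerate if (a) $A_1,\dots,A_k$ are linearly independent and (b) $F(z,\zeta)=0$ for all $z\in\mathbb C^m$ implies $\zeta=0$. $F$ is strongly pseudoconvex if it is nondegenerate and there is $c\in\mathbb R^k$ such that $\sum_j c_jA_j$ is positive definite. For a set $S\subset\mathbb C^m$ put $S^F=\{x\in\mathbb C^m:\ F(x,y)=0\ \ \forall y\in S\}$. For $a\in\mathbb C^m$ put $T(a)=\{y\in\mathbb C^m:\ \exists x\in\mathbb C^m,\ F(x,a)+F(a,y)=0\}$. A property holds for generic $a\in\mathbb C^m$ if it holds for all $a$ in some open dense subset of $\mathbb C^m$. A nondegenerate form $F$ is T-nondegenerate if $T(a)^F=0$ for generic $a\in\mathbb C^m$. With coordinates $z\in\mathbb C^m$, $w=u+iv\in\mathbb C^k$, $\mathfrak g=\sum_{p\ge-2}\mathfrak g_p$ is the graded Lie algebra of infinitesimal CR automorphisms of the quadric $v=F(z,z)$. Giving $z_j,w_j,\partial/\partial z_j,\partial/\partial w_j$ weights $1,2,-1,-2$, $\mathfrak g_p$ is the subspace of weighted homogeneous elements of degree $p$, i.e. the space of vector fields $f\frac{\partial}{\partial z}+g\frac{\partial}{\partial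 w}$ with $f$ ($\mathbb C^m$-valued) and $g$ ($\mathbb C^k$-valued) weighted homogeneous holomorphic polynomials in $(z,w)$ of weighted degrees $p+1$ and $p+2$ such that $\operatorname{Im}(g-2iF(f,z))|_{w=u+iF(z,z)}=0$ for all $z\in\mathbb C^m$, $u\in\mathbb R^k$. In particular, $\mathfrak g_3$ is the case $p=3$. *)

(* Defs.v *)
From HB Require Import structures.
From mathcomp Require Import all_boot all_order all_algebra.
From mathcomp Require mpoly.
From mathcomp Require Import complex.
From mathcomp Require Import boolp classical_sets reals topology.
From mathcomp Require Import normedtype.
Export -(notations) mpoly.

Set Implicit Arguments.
Unset Strict Implicit.
Unset Printing Implicit Defensive.

Import Order.TTheory GRing.Theory Num.Theory.
Import numFieldTopology.Exports.

Local Open Scope classical_set_scope.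
Local Open Scope ring_scope.

(* The library puts the norm topology on the regular module [R[i]^o] only. *)
HB.instance Definition _ (R : realType) := PseudoPointedMetric.copy R[i] R[i]^o.

Section HermitianForm.
Variables (R : realType) (m k : nat).
Local Notation C := R[i].
Implicit Types (A : 'I_k -> 'M[C]_m) (a b x y z : 'cV[C]_m).

Definition inner a b : C := \sum_(l < m) a l 0 * (b l 0)^*.

Definition hform A a b : 'cV[C]_k := \col_j inner (A j *m a) b.

Definition form_nondegenerate A :=
  free [tuple A j | j < k] /\
  forall zeta, (forall z, hform A z zeta = 0) -> zeta = 0.

Definition positive_definite (M : 'M[C]_m) :=
  forall x, x != 0 -> 0 < inner (M *m x) x.

Definition strongly_pseudoconvex A :=
  form_nondegenerate A /\
  exists c : 'I_k -> R, positive_definite (\sum_(j < k) (c j)%:C%C *: A j).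

Definition orthF A (S : set 'cV[C]_m) : set 'cV[C]_m :=
  [set x | forall y, S y -> hform A x y = 0].

Definition Tset A a : set 'cV[C]_m :=
  [set y | exists x, hform A x a + hform A a y = 0].

Definition generic (P : set 'cV[C]_m) :=
  exists U : set 'cV[C]_m, [/\ open U, dense U & U `<=` P].

Definition T_nondegenerate A :=
  form_nondegenerate A /\ generic [set a | orthF A (Tset A a) = [set 0]].

(* Variables [lshift k l] are the z_l, of weight 1; variables [rshift m j] are
   the w_j, of weight 2. *)
Definition weight (mon : multinom (m + k)) : nat :=
  (\sum_(l < m) mon (lshift k l) + 2 * \sum_(j < k) mon (rshift m j))%N.

(* The degree is an [int]: at degree -1 only the zero polynomial qualifies. *)
Definition whomog (d : int) (q : mpoly (m + k) C) :=
  forall mon, mon \in msupp q -> (weight mon)%:Z = d.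

Definition eval_at n z (w : 'cV[C]_k) (q : 'cV[mpoly (m + k) C]_n) : 'cV[C]_n :=
  map_mx (meval (fun i => col_mx z w i 0)) q.

(* A pair (f, g) stands for the vector field f d/dz + g d/dw. *)
Local Notation vfield :=
  ('cV[mpoly (m + k) C]_m * 'cV[mpoly (m + k) C]_k)%type.

Definition tangent A (X : vfield) :=
  forall z (u : 'cV[R]_k),
    let w := map_mx (real_complex R) u + 'i *: hform A z z in
    forall j, 'Im ((eval_at z w X.2 - (2 * 'i) *: hform A (eval_at z w X.1) z) j 0) = 0.

Definition gcomp A (p : int) : set vfield :=
  [set X : vfield | [/\ forall l, whomog (p + 1) (X.1 l 0),
               forall j, whomog (p + 2) (X.2 j 0) & tangent A X]].

End HermitianForm.

(* Main.v *)
Require Import Defs.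
From mathcomp Require Import all_boot all_order all_algebra.
From mathcomp Require Import ring zify.
From mathcomp Require Import complex boolp classical_sets reals topology.
Set Implicit Arguments.
Unset Strict Implicit.
Unset Printing Implicit Defensive.
Import Order.TTheory GRing.Theory Num.Theory.
Local Open Scope classical_set_scope.
Local Open Scope ring_scope.

(** Write F for the form. The positivity hypothesis enters only through its
    consequence that F(x, x) = 0 forces x = 0: pairing F(x, x) with the given
    real vector c yields a positive definite form in x.

    T-nondegeneracy then holds at every a ([orthF_Tset]). Since F(-a, a) +
    F(a, a) = 0, the point a lies in T(a); so x in T(a)^F satisfies F(x, a) = 0,
    hence F(a, x) = 0, which puts x itself in T(a) (take 0 as the companion of
    x). Thus F(x, x) = 0 and x = 0.

    For g_3, let (f, g) be a field of degree 3. By weights f(z, w) = a(z) +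
    b(z) w + c(w, w), where a and b are homogeneous of degree 4 and 2 and c is
    bilinear symmetric ([whomog4_mx]), and g(0, w) = 0. Tangency says that an
    expression polynomial in z, its conjugate and real u is real, so it can be
    polarised: z and its conjugate may be replaced by independent x and conj(y)
    ([tangent_polar]). Putting y = 0 gives g(x, w) = 2i F(x, f(0, conj w)), so g
    is determined by f. Replacing (x, y) by (t x, y / t) and comparing powers of
    t gives, for all x, y and complex w,
      F(a(x), y) = 0,
      F(b(x) F(x, y), y) = 0,
      F(b(x) w, y) = 4i F(x, c(conj w, F(y, x))).
    The first kills a. The other two are treated by the same device three times:
    choose the free variable so that a vector r built from b or c is forced to
    satisfy F(r, r) = 0. This gives c(F(x, x), F(x, x)) = 0, then b = 0, then
    c = 0 ([quadratic_coefficient_eq0], [bilinear_coefficient_eq0]); the last two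
    steps use that the values F(x, x) span C^k, because the matrices A_j are
    linearly independent ([hform_span]). *)

(** * Polynomial functions of one complex variable *)

Section PolynomialFunctions.
Variable C : numClosedFieldType.
Implicit Types (h : C -> C) (p : {poly C}).

Lemma poly_eq0_of_nat p : (forall n : nat, p.[n.+1%:R] = 0) -> p = 0.
Proof.
move=> p0; apply/eqP/negP => /negP pN0.
have := max_poly_roots pN0 (rs := [seq n.+1%:R | n <- iota 0 (size p)]).
rewrite size_map size_iota ltnn; move=> H; suff: false by []; apply: H.
  by apply/allP => _ /mapP[n _ ->]; apply/rootP.
by rewrite map_inj_uniq ?iota_uniq // => i j /eqP; rewrite eqr_nat => /eqP[].
Qed.

(** Polynomiality as a property of functions, so that it can be carried through
    substitutions without exhibiting the polynomials. *)
Definition polyfun h := exists p, forall s, h s = p.[s].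

Lemma polyfun_eq h1 h2 : h1 =1 h2 -> polyfun h1 -> polyfun h2.
Proof. by move=> e [p hp]; exists p => s; rewrite -e. Qed.

Lemma polyfun_cst a : polyfun (fun=> a).
Proof. by exists a%:P => s; rewrite hornerC. Qed.

Lemma polyfun_id : polyfun id.
Proof. by exists 'X => s; rewrite hornerX. Qed.

Lemma polyfunD h1 h2 : polyfun h1 -> polyfun h2 -> polyfun (fun s => h1 s + h2 s).
Proof. by move=> [p1 e1] [p2 e2]; exists (p1 + p2) => s; rewrite hornerD e1 e2. Qed.

Lemma polyfunM h1 h2 : polyfun h1 -> polyfun h2 -> polyfun (fun s => h1 s * h2 s).
Proof. by move=> [p1 e1] [p2 e2]; exists (p1 * p2) => s; rewrite hornerM e1 e2. Qed.

Lemma polyfunN h : polyfun h -> polyfun (fun s => - h s).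
Proof. by move=> [p e]; exists (- p) => s; rewrite hornerN e. Qed.

Lemma polyfunX h n : polyfun h -> polyfun (fun s => h s ^+ n).
Proof. by move=> [p e]; exists (p ^+ n) => s; rewrite horner_exp e. Qed.

Lemma polyfun_sum (I : Type) (r : seq I) (H : I -> C -> C) :
  (forall i, polyfun (H i)) -> polyfun (fun s => \sum_(i <- r) H i s).
Proof.
move=> pH; elim: r => [|i r IH].
  by apply: polyfun_eq (polyfun_cst 0) => s; rewrite big_nil.
by apply: polyfun_eq (polyfunD (pH i) IH) => s; rewrite big_cons.
Qed.

Lemma polyfun_prod (I : Type) (r : seq I) (H : I -> C -> C) :
  (forall i, polyfun (H i)) -> polyfun (fun s => \prod_(i <- r) H i s).
Proof.
move=> pH; elim: r => [|i r IH].
  by apply: polyfun_eq (polyfun_cst 1) => s; rewrite big_nil.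
by apply: polyfun_eq (polyfunM (pH i) IH) => s; rewrite big_cons.
Qed.

(** Conjugating both the argument and the value conjugates the coefficients. *)
Lemma polyfun_conj h : polyfun h -> polyfun (fun s => (h s^*)^*).
Proof.
move=> [p e]; exists (map_poly Num.conj p) => s.
by rewrite e -{2}(conjCK s) horner_map.
Qed.

(** This is what replaces analytic continuation from the real line: a nonzero
    polynomial has finitely many roots. *)
Lemma polyfun_eq0_real h :
  polyfun h -> (forall s, s \is Num.real -> h s = 0) -> forall s, h s = 0.
Proof.
move=> [p e] h0 s; rewrite e (_ : p = 0) ?horner0 //.
by apply: poly_eq0_of_nat => n; rewrite -e h0 ?realn.
Qed.

Lemma polyfun_meval n (q : mpoly n C) (v : C -> 'I_n -> C) :
  (forall i, polyfun (v^~ i)) -> polyfun (fun s => meval (v s) q).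
Proof.
move=> pv; apply: (@polyfun_eq (fun s =>
    \sum_(d <- msupp q) mcoeff d q * \prod_i v s i ^+ d i)) => [s|].
  by rewrite mevalE.
apply: polyfun_sum => d; apply: polyfunM (polyfun_cst _) _.
by apply: polyfun_prod => i; exact: polyfunX.
Qed.

End PolynomialFunctions.

(** Uniqueness of base N digits; it separates the monomials in [meval_eq0]. *)
Lemma digits_inj (N n : nat) (d e : 'I_n -> nat) :
  (forall i, d i < N)%N -> (forall i, e i < N)%N ->
  (\sum_(i < n) d i * N ^ i = \sum_(i < n) e i * N ^ i)%N -> d =1 e.
Proof.
elim: n d e => [|n IH] d e dN eN; first by move=> _ [].
rewrite !big_ord_recl /= !expn0 !muln1.
have step (f : 'I_n.+1 -> nat) : (\sum_(i < n) f (lift ord0 i) * N ^ bump 0 i =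
    (\sum_(i < n) f (lift ord0 i) * N ^ i) * N)%N.
  by rewrite big_distrl; apply: eq_bigr => i _; rewrite /bump /= expnS mulnCA mulnC.
rewrite !step => E.
have E0 : d ord0 = e ord0.
  by have := congr1 (modn^~ N) E; rewrite ![(_ + _ * N)%N]addnC !modnMDl !modn_small.
have N0 : (0 < N)%N by apply: leq_ltn_trans (dN ord0).
have {}E : (\sum_(i < n) d (lift ord0 i) * N ^ i =
    \sum_(i < n) e (lift ord0 i) * N ^ i)%N.
  by move: E; rewrite E0 => /addnI /eqP; rewrite eqn_pmul2r // => /eqP.
move=> i; case: (unliftP ord0 i) => [j ->|-> //].
exact: (IH (fun i => d (lift ord0 i)) (fun i => e (lift ord0 i))).
Qed.

(** Kronecker substitution: with N above all exponents, evaluating at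
    (t, t^N, t^(N^2), ...) turns distinct monomials into distinct powers of t. *)
Lemma meval_eq0 (C : numClosedFieldType) n (q : mpoly n C) :
  (forall v, meval v q = 0) -> q = 0.
Proof.
move=> q0; pose N := (\max_(d <- msupp q) \max_(i < n) d i).+1.
have ltN d i : d \in msupp q -> (d i < N)%N.
  move=> dq; rewrite ltnS; apply: (@leq_trans (\max_(i < n) d i)).
    exact: (leq_bigmax i).
  exact: (leq_bigmax_seq _ (F := fun d : multinom n => (\max_(i < n) d i)%N) dq).
pose code (d : multinom n) := (\sum_(i < n) d i * N ^ i)%N.
pose p : {poly C} := \sum_(d <- msupp q) mcoeff d q *: 'X^(code d).
have p0 : p = 0.
  apply: poly_eq0_of_nat => m; rewrite -[RHS](q0 (fun i => m.+1%:R ^+ (N ^ i))).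
  rewrite mevalE horner_sum; apply: eq_bigr => d _.
  rewrite hornerZ hornerXn /code expr_sum; congr (_ * _).
  by apply: eq_bigr => i _; rewrite -exprM mulnC.
apply/mpolyP => d; rewrite mcoeff0; have [dq|dNq] := boolP (d \in msupp q); last first.
  by apply/eqP; rewrite mcoeff_eq0.
have := congr1 (fun p : {poly C} => p`_(code d)) p0.
rewrite coef0 coef_sum (bigD1_seq d) ?msupp_uniq //= coefZ coefXn eqxx mulr1.
rewrite big1_seq ?addr0 // => e /andP[eNd eq]; rewrite coefZ coefXn.
case: eqP; rewrite ?mulr0 // => E; case/eqP: eNd.
by apply/mnmP => i; rewrite (digits_inj _ _ E) // => j; exact: ltN.
Qed.

(** * Polarisation and the algebra of the form *)

(** Here P is meant to be holomorphic in its first argument and antiholomorphic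
    in its second. On the real line s, the points p + s q and p + conj(s) q agree,
    so the polynomial in s vanishes there, hence also at s = i; and any pair
    (x, y) is (p + i q, p - i q) for suitable p and q. *)
Lemma polarize_antihol (C : numClosedFieldType) n (P : 'cV[C]_n -> 'cV[C]_n -> C) :
  (forall p q, polyfun (fun s => P (p + s *: q) (p + s^* *: q))) ->
  (forall z, P z z = 0) -> forall x y, P x y = 0.
Proof.
move=> pP P0 x y.
pose p : 'cV[C]_n := 2^-1 *: (x + y).
pose q : 'cV[C]_n := (2 * 'i)^-1 *: (x - y).
have iN0 : 'i != 0 :> C := neq0Ci C.
have -> : x = p + 'i *: q by apply/colP => i; rewrite !mxE; field.
have -> : y = p + 'i^* *: q by apply/colP => i; rewrite conjCi !mxE; field.
apply: (polyfun_eq0_real (pP p q)) => s sR.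
by rewrite (CrealP sR).
Qed.

Section HermitianFormTheory.
Variables (R : realType) (m k : nat) (A : 'I_k -> 'M[R[i]]_m).
Hypothesis hermA : forall j, A j \is hermsymmx.
Local Notation C := R[i].
Local Notation F := (hform A).
Local Notation cvc := (map_mx Num.conj).
Implicit Types (x y z p q h : 'cV[C]_m) (u v w : 'cV[C]_k).

Lemma hformDl x y z : F (x + y) z = F x z + F y z.
Proof.
apply/colP => j; rewrite !mxE /inner mulmxDr -big_split.
by apply: eq_bigr => l _; rewrite mxE mulrDl.
Qed.

Lemma hformDr x y z : F z (x + y) = F z x + F z y.
Proof.
apply/colP => j; rewrite !mxE /inner -big_split.
by apply: eq_bigr => l _; rewrite [(x + y) l 0]mxE rmorphD mulrDr.
Qed.

Lemma hformZl a x y : F (a *: x) y = a *: F x y.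
Proof.
apply/colP => j; rewrite !mxE /inner -scalemxAr mulr_sumr.
by apply: eq_bigr => l _; rewrite mxE mulrA.
Qed.

Lemma hformZr a x y : F x (a *: y) = a^* *: F x y.
Proof.
apply/colP => j; rewrite !mxE /inner mulr_sumr.
by apply: eq_bigr => l _; rewrite [(a *: y) l 0]mxE rmorphM mulrCA.
Qed.

Lemma hformNl x y : F (- x) y = - F x y.
Proof. by rewrite -[- x]scaleN1r hformZl scaleN1r. Qed.

Lemma hformNr x y : F x (- y) = - F x y.
Proof. by rewrite -[- y]scaleN1r hformZr rmorphN1 scaleN1r. Qed.

Lemma hform0l y : F 0 y = 0.
Proof. by rewrite -(scale0r (0 : 'cV_m)) hformZl scale0r. Qed.

Lemma hform0r x : F x 0 = 0.
Proof. by rewrite -(scale0r (0 : 'cV_m)) hformZr conjC0 scale0r. Qed.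

Lemma hform_conj x y : F y x = cvc (F x y).
Proof.
apply/colP => j; rewrite !mxE /inner rmorph_sum /=.
under eq_bigr do rewrite mxE big_distrl.
under [RHS]eq_bigr do rewrite mxE rmorphM /= conjCK rmorph_sum big_distrl /=.
rewrite exchange_big; apply: eq_bigr => l _; apply: eq_bigr => i _ /=.
have /is_hermitianmxP/matrixP/(_ i l) := hermA j.
by rewrite expr0 scale1r !mxE => ->; rewrite rmorphM /=; ring.
Qed.

Lemma hform_eq0C x y : F x y = 0 -> F y x = 0.
Proof. by move=> e; rewrite hform_conj e map_mx0. Qed.

Lemma polyfun_hform p q j : polyfun (fun s => F (p + s *: q) (p + s^* *: q) j 0).
Proof.
apply: (@polyfun_eq _ (fun s => F p p j 0 + s * (F p q j 0 + F q p j 0)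
    + s ^+ 2 * F q q j 0)).
  move=> s; rewrite hformDl !hformDr !hformZl !hformZr conjCK.
  by move: (F p p) (F p q) (F q p) (F q q) => f1 f2 f3 f4; rewrite !mxE; ring.
apply: polyfunD; last first.
  by apply: polyfunM (polyfun_cst _); apply: polyfunX; apply: polyfun_id.
apply: polyfunD (polyfun_cst _) _; apply: polyfunM (polyfun_cst _).
exact: polyfun_id.
Qed.

Lemma hform_polar_eq0 (G : 'M[C]_(m, k)) :
  (forall x, G *m F x x = 0) -> forall x y, G *m F x y = 0.
Proof.
move=> G0 x y; apply/colP => i; rewrite [RHS]mxE.
apply: (polarize_antihol (P := fun x y => (G *m F x y) i 0)) => [p q|z]; last first.
  by rewrite G0 mxE.
apply: polyfun_eq (polyfun_sum _ (fun j => polyfunM (polyfun_cst (G i j)) (polyfun_hform p q j))).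
by move=> s /=; rewrite mxE.
Qed.

Lemma inner_mulmx_eq0 (M : 'M[C]_m) : (forall x y, inner (M *m x) y = 0) -> M = 0.
Proof.
move=> M0; apply/matrixP => i j; have := M0 (delta_mx j 0) (delta_mx i 0).
rewrite /inner (bigD1 i) //= big1 => [|l /negPf li]; last first.
  by rewrite !mxE li /= conjC0 mulr0.
by rewrite -colE !mxE !eqxx /= conjC1 mulr1 addr0.
Qed.

Lemma inner_pencil (e : 'I_k -> C) x y :
  inner ((\sum_(j < k) e j *: A j) *m x) y = \sum_(j < k) e j * F x y j 0.
Proof.
rewrite /inner mulmx_suml.
under eq_bigr do rewrite summxE big_distrl /=.
rewrite exchange_big; apply: eq_bigr => j _ /=; rewrite !mxE /inner mulr_sumr.
by apply: eq_bigr => l _; rewrite -scalemxAl mxE mulrA.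
Qed.

(** The values F(x, x) span C^k: by polarisation a linear relation between them
    is a linear relation between the A_j. *)
Lemma hform_span (G : 'M[C]_(m, k)) : free [tuple A j | j < k] ->
  (forall x, G *m F x x = 0) -> G = 0.
Proof.
move=> frA /hform_polar_eq0 G0; apply/matrixP => i j; rewrite [RHS]mxE.
apply: (freeP frA (fun j => G i j)).
under eq_bigr do rewrite -tnth_nth tnth_mktuple.
apply: inner_mulmx_eq0 => x y; rewrite inner_pencil.
by have := congr1 (fun w : 'cV_m => w i 0) (G0 x y); rewrite !mxE.
Qed.

Lemma positive_hform_eq0 :
  (exists c : 'I_k -> R, positive_definite (\sum_(j < k) (c j)%:C%C *: A j)) ->
  forall x, F x x = 0 -> x = 0.
Proof.
move=> [c pc] x Fx0; apply/eqP/negP => /negP /pc.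
rewrite inner_pencil.
by rewrite Fx0 big1 ?ltxx // => j _; rewrite mxE mulr0.
Qed.

Section PositiveForm.
Hypothesis posF : forall x, F x x = 0 -> x = 0.

(** Both a and the points x of T(a)^F lie in T(a), so F(x, x) = 0. *)
Lemma orthF_Tset a : orthF A (Tset A a) = [set 0].
Proof.
apply/seteqP; split => [x Tx|_ -> y _ /=]; last by rewrite hform0l.
have Ta : Tset A a a by exists (- a); rewrite hformNl addNr.
have Fxa : F a x = 0 by apply: hform_eq0C; apply: Tx.
by apply: posF; apply: Tx; exists 0; rewrite hform0l Fxa addr0.
Qed.

Hypothesis frA : free [tuple A j | j < k].

(* For u in C^k the matrix [c u] represents the linear map c(u, .), and [b x]
   represents b(x). *)
Variables (b : 'cV[C]_m -> 'M[C]_(m, k)) (c : 'cV[C]_k -> 'M[C]_(m, k)).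
Hypothesis csym : forall u v, c u *m v = c v *m u.
Hypothesis Fb0 : forall x y, F (b x *m F x y) y = 0.
Hypothesis Fbc : forall x y u,
  F (b x *m u) y = (4 * 'i) *: F x (c (cvc u) *m F y x).

Let cDl u v w : c (u + v) *m w = c u *m w + c v *m w.
Proof. by rewrite csym mulmxDr !(csym w). Qed.

Let i4N0 : 4 * 'i != 0 :> C.
Proof. by rewrite mulf_neq0 ?neq0Ci ?pnatr_eq0. Qed.

Let Fc0 x y : F x (c (F y x) *m F y x) = 0.
Proof.
have := Fbc x y (F x y); rewrite Fb0 -hform_conj => /esym/eqP.
by rewrite scaler_eq0 (negPf i4N0) => /eqP.
Qed.

Let cNl u w : c (- u) *m w = - (c u *m w).
Proof. by rewrite csym mulmxN csym. Qed.

(** The derivative in the direction h of the cubic identity [Fc0]: for a cubic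
    map Q, the part of Q(a + h) that is linear in h is
    (Q(a + h) - Q(a - h)) / 2 - Q(h). *)
Let Fc0_deriv a h y :
  F h (c (F y a) *m F y a) + 2 *: F a (c (F y h) *m F y a) = 0.
Proof.
have Ep := Fc0 (a + h) y; have Em := Fc0 (a - h) y; have Eh := Fc0 h y.
move: Ep Em Eh; rewrite !(hformDl, hformDr, hformNl, hformNr).
rewrite !(mulmxDr, mulmxN, cDl, cNl) !(hformDl, hformDr, hformNl, hformNr).
rewrite !(csym (F y a) (F y h)).
move: (F a (c (F y a) *m F y a)) (F a (c (F y h) *m F y a)) (F a (c (F y h) *m F y h)).
move: (F h (c (F y a) *m F y a)) (F h (c (F y h) *m F y a)) (F h (c (F y h) *m F y h)).
move=> f1 f2 f3 f4 f5 f6 Ep Em Eh; apply/colP => j.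
move/colP/(_ j): Ep; move/colP/(_ j): Em; move/colP/(_ j): Eh; rewrite !mxE => Eh Em Ep.
apply: (mulfI (_ : 2 != 0 :> C)); first by rewrite pnatr_eq0.
have comb (e1 e2 e3 : C) : e1 = 0 -> e2 = 0 -> e3 = 0 -> e1 - e2 - 2 * e3 = 2 * 0.
  by move=> -> -> ->; ring.
by apply: etrans (comb _ _ _ Ep Em Eh); ring.
Qed.

(** In [Fc0_deriv] take y = a = x and h = r := c(F(x, x), F(x, x)): since
    F(x, r) = 0, only F(r, r) survives. *)
Let cFxx x : c (F x x) *m F x x = 0.
Proof.
set r := c _ *m _; apply: posF; have Fxr : F x r = 0 by exact: Fc0.
by have := Fc0_deriv x r x; rewrite Fxr (csym 0) mulmx0 hform0r scaler0 addr0.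
Qed.

Let cE u i l : c u i l = \sum_j c (delta_mx l 0) i j * u j 0.
Proof.
have -> : c u i l = (c u *m (delta_mx l 0 : 'cV_k)) i 0 by rewrite -colE mxE.
by rewrite csym mxE.
Qed.

Let cFxy x y : c (F x y) *m F x y = 0.
Proof.
apply/colP => i; rewrite [RHS]mxE.
apply: (polarize_antihol (P := fun x y => (c (F x y) *m F x y) i 0)) => [p q|z]; last first.
  by rewrite cFxx mxE.
apply: (@polyfun_eq _ (fun s => \sum_l (\sum_j c (delta_mx l 0) i j *
   F (p + s *: q) (p + s^* *: q) j 0) * F (p + s *: q) (p + s^* *: q) l 0)).
  by move=> s; rewrite [RHS]mxE; apply: eq_bigr => l _; rewrite cE.
apply: polyfun_sum => l; apply: polyfunM (polyfun_hform _ _ _).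
by apply: polyfun_sum => j; apply: polyfunM (polyfun_cst _) (polyfun_hform _ _ _).
Qed.

(** Now the first term of [Fc0_deriv] vanishes, and the second one is
    F(b(a) F(h, y), y) up to a constant. *)
Let Fb0_gen a h y : F (b a *m F h y) y = 0.
Proof.
have := Fc0_deriv a h y; rewrite cFxy hform0r add0r => /eqP.
rewrite scaler_eq0 pnatr_eq0 /= => /eqP E.
by rewrite Fbc -hform_conj E scaler0.
Qed.

(** Polarise [Fb0_gen] in y towards r := b(x) F(y, y), with h = y: since
    F(y, r) = 0, only F(r, r) survives. *)
Lemma quadratic_coefficient_eq0 x : b x = 0.
Proof.
apply: hform_span => // y; set r := _ *m _; apply: posF.
have Fyr : F y r = 0 by apply: hform_eq0C; exact: Fb0_gen.
have := Fb0_gen x y (y + r); rewrite !hformDr Fyr addr0.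
by rewrite -/r Fb0_gen add0r.
Qed.

(** With b = 0 the form F(x, c(w, F(y, x))) vanishes. Polarise it in x, from y
    towards r := c(u, F(y, y)): since F(y, r) = 0, only F(r, r) survives. *)
Lemma bilinear_coefficient_eq0 u v : c u *m v = 0.
Proof.
have Fc w x y : F x (c w *m F y x) = 0.
  apply/eqP; have := Fbc x y (cvc w); rewrite quadratic_coefficient_eq0 mul0mx hform0l.
  rewrite (_ : cvc (cvc w) = w); last by apply/colP => i; rewrite !mxE conjCK.
  by move=> /esym/eqP; rewrite scaler_eq0 (negPf i4N0).
suff -> : c u = 0 by rewrite mul0mx.
apply: hform_span => // y; set r := _ *m _; apply: posF.
have Fyr : F y r = 0 by exact: Fc.
have := Fc u (y + r) y; rewrite hformDr Fyr addr0 hformDl -/r.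
by rewrite Fyr add0r.
Qed.
End PositiveForm.
End HermitianFormTheory.

(** * Weighted homogeneous polynomials *)

Section Monomials.
Variables (C : comNzRingType) (n : nat).
Implicit Types (d e : 'I_n -> nat) (x : 'I_n -> C).

Lemma monomial_deg0 d x : (\sum_i d i = 0)%N -> \prod_i x i ^+ d i = 1.
Proof.
move=> /eqP; rewrite sum_nat_eq0 => /forallP d0; apply: big1 => i _.
by rewrite (eqP (d0 i)) expr0.
Qed.

Lemma monomial_degS d r : (\sum_i d i = r.+1)%N ->
  exists j e, (\sum_i e i = r)%N /\
    forall x, \prod_i x i ^+ d i = x j * \prod_i x i ^+ e i.
Proof.
move=> dr; have [j dj|d0] := pickP (fun j => 0 < d j)%N; last first.
  by rewrite big1 // in dr => i _; have := d0 i; case: (d i).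
exists j, (fun i => if i == j then (d i).-1 else d i); split.
  rewrite (bigD1 j) //= in dr; rewrite (bigD1 j) //= eqxx.
  under eq_bigr => i /negPf ij do rewrite ij.
  lia.
move=> x; rewrite (bigD1 j) //= [in RHS](bigD1 j) //= eqxx.
under [in RHS]eq_bigr => i /negPf ij do rewrite ij.
by rewrite mulrA -exprS prednK.
Qed.

Lemma monomial_scale d t x :
  \prod_i (t * x i) ^+ d i = t ^+ (\sum_i d i) * \prod_i x i ^+ d i.
Proof.
rewrite expr_sum -big_split; apply: eq_bigr => i _ /=; exact: exprMn.
Qed.
End Monomials.

Section WeightedHomogeneous.
Variables (R : realType) (m k : nat).
Local Notation C := R[i].
Implicit Types (q : mpoly (m + k) C) (x : 'cV[C]_m) (w : 'cV[C]_k).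

Local Notation ev x w q := (meval (fun i => col_mx x w i 0) q).

Lemma meval_col_mx q x w : ev x w q = \sum_(d <- msupp q) mcoeff d q *
  ((\prod_l x l 0 ^+ d (lshift k l)) * (\prod_j w j 0 ^+ d (rshift m j))).
Proof.
rewrite mevalE; apply: eq_bigr => d _; rewrite big_split_ord; congr (_ * (_ * _)).
  by apply: eq_bigr => l _; rewrite col_mxEu.
by apply: eq_bigr => l _; rewrite col_mxEd.
Qed.

Lemma whomog5_at0 q w : whomog 5 q -> ev 0 w q = 0.
Proof.
move=> q5; rewrite meval_col_mx big1_seq // => d /andP[_ /q5 [dw]].
have [l dl|d0] := pickP (fun l : 'I_m => 0 < d (lshift k l))%N.
  by rewrite (bigD1 l) //= mxE expr0n; case: (d _) dl => // ? _; rewrite !mul0r mulr0.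
move: dw; rewrite /weight big1 => [|l _]; last by have := d0 l; case: (d _).
lia.
Qed.

(** A weighted homogeneous Q of degree 4 is a quartic in x, plus a quadric in x
    times a linear form in w, plus a quadratic form in w; T collects these three
    coefficients. *)
Definition wdec4 (Q : 'cV[C]_m -> 'cV[C]_k -> C)
   (T : ('cV[C]_m -> C) * ('cV[C]_m -> 'I_k -> C) * ('I_k -> 'I_k -> C)) :=
  [/\ forall t x, T.1.1 (t *: x) = t ^+ 4 * T.1.1 x,
      forall t x j, T.1.2 (t *: x) j = t ^+ 2 * T.1.2 x j
    & forall x w, Q x w = T.1.1 x + \sum_j T.1.2 x j * w j 0
         + \sum_j (\sum_i T.2 i j * w i 0) * w j 0].

Lemma wdec4_monomial (d : 'I_m -> nat) (e : 'I_k -> nat) :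
  (\sum_l d l + 2 * \sum_j e j = 4)%N ->
  exists T, wdec4 (fun x w => (\prod_l x l 0 ^+ d l) * (\prod_j w j 0 ^+ e j)) T.
Proof.
have dhom t x : \prod_l (t *: x) l 0 ^+ d l = t ^+ (\sum_l d l) * \prod_l x l 0 ^+ d l.
  by rewrite -monomial_scale; apply: eq_bigr => l _; rewrite mxE.
case E : (\sum_j e j)%N => [|[|[|r]]] dw; last by lia.
- exists (fun x => \prod_l x l 0 ^+ d l, fun _ _ => 0, fun _ _ => 0); split=> /=.
  + by move=> t x; rewrite dhom; congr (t ^+ _ * _); lia.
  + by move=> *; rewrite mulr0.
  + move=> x w; rewrite (monomial_deg0 _ E) mulr1 [X in _ + X]big1 => [|j _].
      by rewrite addr0 [X in _ + X]big1 ?addr0 // => j _; rewrite mul0r.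
    by rewrite big1 ?mul0r // => i _; rewrite mul0r.
- have [j [e' [e'0 ej]]] := monomial_degS C E.
  exists (fun=> 0, fun x i => (i == j)%:R * \prod_l x l 0 ^+ d l, fun _ _ => 0); split=> /=.
  + by move=> *; rewrite mulr0.
  + by move=> t x i; rewrite dhom mulrCA; congr (t ^+ _ * _); lia.
  + move=> x w; rewrite ej (monomial_deg0 _ e'0) mulr1 add0r [X in _ + X]big1 ?addr0.
      rewrite (bigD1 j) //= eqxx mul1r [X in _ + X]big1 ?addr0; first by rewrite mulrC.
      by move=> i /negPf ->; rewrite !mul0r.
    by move=> i _; rewrite big1 ?mul0r // => i' _; rewrite mul0r.
- have [j [e' [e'1 ej]]] := monomial_degS C E.
  have [j' [e'' [e''0 ej']]] := monomial_degS C e'1.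
  exists (fun=> 0, fun _ _ => 0, fun i i' => (i == j)%:R * (i' == j')%:R); split=> /=.
  + by move=> *; rewrite mulr0.
  + by move=> *; rewrite mulr0.
  + move=> x w; have d0 : (\sum_l d l = 0)%N by lia.
    rewrite ej ej' (monomial_deg0 _ d0) (monomial_deg0 _ e''0) mul1r mulr1 add0r.
    rewrite [X in X + _]big1 ?add0r; last by move=> i _; rewrite mul0r.
    rewrite (bigD1 j') //= [X in _ + X]big1 ?addr0; last first.
      by move=> i /negPf ->; rewrite big1 ?mul0r // => i' _; rewrite mulr0 mul0r.
    rewrite (bigD1 j) //= !eqxx !mul1r [X in _ + X]big1 ?addr0 //.
    by move=> i /negPf ->; rewrite !mul0r.
Qed.

Lemma whomog4_dec q : whomog 4 q -> exists T, wdec4 (fun x w => ev x w q) T.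
Proof.
move=> q4.
suff [T [T1 T2 T3]] : exists T, wdec4 (fun x w => \sum_(d <- msupp q) mcoeff d q *
  ((\prod_l x l 0 ^+ d (lshift k l)) * (\prod_j w j 0 ^+ d (rshift m j)))) T.
  by exists T; split => // x w; rewrite meval_col_mx T3.
elim: {q4}(msupp q) (fun d dq => q4 d dq) => [|d r IH] q4.
  exists (fun=> 0, fun _ _ => 0, fun _ _ => 0); split=> /=.
  + by move=> *; rewrite mulr0.
  + by move=> *; rewrite mulr0.
  + move=> x w; rewrite big_nil [X in _ + X]big1 => [|j _].
      by rewrite addr0 add0r big1 // => j _; rewrite mul0r.
    by rewrite big1 ?mul0r // => i _; rewrite mul0r.
have [|[[a1 b1] c1] [/= h1 h1' e1]] := IH.
  by move=> e er; apply: q4; rewrite inE er orbT.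
have [|[[a2 b2] c2] [/= h2 h2' e2]] :=
    @wdec4_monomial (fun l => d (lshift k l)) (fun j => d (rshift m j)).
  by have [] := q4 d (mem_head _ _).
exists (fun x => mcoeff d q * a2 x + a1 x, fun x j => mcoeff d q * b2 x j + b1 x j,
  fun i j => mcoeff d q * c2 i j + c1 i j); split=> /=.
+ by move=> t x; rewrite h1 h2; ring.
+ by move=> t x j; rewrite h1' h2'; ring.
+ move=> x w; rewrite big_cons e1 e2.
  under [in RHS]eq_bigr do rewrite mulrDl -mulrA.
  under [X in _ = _ + X]eq_bigr => j _.
    under eq_bigr do rewrite mulrDl -mulrA.
    rewrite big_split /= -mulr_sumr mulrDl -mulrA; over.
  rewrite !big_split /= -!mulr_sumr; ring.
Qed.

(** The coefficients of the components of f are assembled into matrices, and the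
    quadratic form in w is symmetrised. *)
Lemma whomog4_mx (f : 'cV[mpoly (m + k) C]_m) : (forall l, whomog 4 (f l 0)) ->
  exists (a : 'cV[C]_m -> 'cV[C]_m) (b : 'cV[C]_m -> 'M[C]_(m, k))
    (c : 'cV[C]_k -> 'M[C]_(m, k)),
  [/\ forall t x, a (t *: x) = t ^+ 4 *: a x,
      forall t x, b (t *: x) = t ^+ 2 *: b x,
      forall u v, c u *m v = c v *m u
    & forall x w, eval_at x w f = a x + b x *m w + c w *m w].
Proof.
move=> f4; have /choice[T HT] : forall l, exists T, wdec4 (fun x w => ev x w (f l 0)) T.
  by move=> l; exact: whomog4_dec.
exists (fun x => \col_l (T l).1.1 x), (fun x => \matrix_(l, j) (T l).1.2 x j),
  (fun u => \matrix_(l, j) \sum_i (2^-1 * ((T l).2 i j + (T l).2 j i)) * u i 0); split.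
- by move=> t x; apply/colP => l; have [h _ _] := HT l; rewrite !mxE h.
- by move=> t x; apply/matrixP => l j; have [_ h _] := HT l; rewrite !mxE h.
- move=> u v; apply/colP => l; rewrite !mxE.
  under eq_bigr do rewrite mxE big_distrl /=.
  under [RHS]eq_bigr do rewrite mxE big_distrl /=.
  by rewrite exchange_big; apply: eq_bigr => i _; apply: eq_bigr => j _ /=; ring.
- move=> x w; apply/colP => l; have [_ _ h] := HT l; rewrite !mxE h; congr (_ + _ + _).
    by apply: eq_bigr => j _; rewrite mxE.
  pose S := \sum_j (\sum_i (T l).2 i j * w i 0) * w j 0.
  have S' : S = \sum_j (\sum_i (T l).2 j i * w i 0) * w j 0.
    rewrite /S; under eq_bigr do rewrite big_distrl.
    under [RHS]eq_bigr do rewrite big_distrl.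
    by rewrite exchange_big; apply: eq_bigr => i _; apply: eq_bigr => j _ /=; ring.
  rewrite -/S (_ : S = 2^-1 * (S + S)); last by field.
  rewrite {2}S' /S -big_split mulr_sumr; apply: eq_bigr => j _ /=.
  rewrite mxE -mulrDl -big_split mulrA mulr_sumr; congr (_ * _).
  by apply: eq_bigr => i _ /=; ring.
Qed.
End WeightedHomogeneous.

(** * Tangent vector fields *)

(** Multiplication by t^3, for the identity obtained from the scaling
    (x, y) -> (t x, y / t). *)
Lemma clear_inverse_powers (K : fieldType) n (t : K) (v1 v2 v3 v4 v5 v6 v7 v8 : 'cV[K]_n) :
  t != 0 ->
  t *: v1 - (t ^+ 4 *: (t^-1 *: v2) + t ^+ 2 *: (t^-1 *: v3) + t^-1 *: v4) =
    t *: (t^-1 ^+ 4 *: v5) + t *: (t^-1 ^+ 2 *: v6) + t *: v7 - t^-1 *: v8 ->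
  t ^+ 4 *: v1 - (t ^+ 6 *: v2 + t ^+ 4 *: v3 + t ^+ 2 *: v4) =
    v5 + t ^+ 2 *: v6 + t ^+ 4 *: v7 - t ^+ 2 *: v8.
Proof.
move=> t0 /(congr1 ( *:%R (t ^+ 3))) e.
transitivity (t ^+ 3 *: (t *: v1 - (t ^+ 4 *: (t^-1 *: v2)
   + t ^+ 2 *: (t^-1 *: v3) + t^-1 *: v4))).
  by apply/colP => j; rewrite !mxE; field.
by rewrite e; apply/colP => j; rewrite !mxE; field.
Qed.

(** The coefficients of t^6 and t^4 in a polynomial identity in t. *)
Lemma scaled_coefficients (C : numClosedFieldType) n (v1 v2 v3 v4 v5 v6 v7 v8 : 'cV[C]_n) :
  (forall r : nat, let t : C := r.+1%:R in
    t ^+ 4 *: v1 - (t ^+ 6 *: v2 + t ^+ 4 *: v3 + t ^+ 2 *: v4) =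
    v5 + t ^+ 2 *: v6 + t ^+ 4 *: v7 - t ^+ 2 *: v8) ->
  v2 = 0 /\ v3 = v1 - v7.
Proof.
move=> /= key.
suff coefs j : v2 j 0 = 0 /\ v1 j 0 - v3 j 0 - v7 j 0 = 0.
  split; apply/colP => j; have [E1 E2] := coefs j; first by rewrite E1 mxE.
  by apply/eqP; rewrite eq_sym -subr_eq0 !mxE addrAC E2.
pose p : {poly C} := Poly [:: - v5 j 0; 0; v8 j 0 - v4 j 0 - v6 j 0; 0;
  v1 j 0 - v3 j 0 - v7 j 0; 0; - v2 j 0].
have p0 : p = 0.
  apply: poly_eq0_of_nat => r; rewrite horner_Poly /=.
  have /colP/(_ j) := key r; rewrite !mxE; set t : C := r.+1%:R => /eqP.
  by rewrite -subr_eq0 => /eqP e; apply: etrans e; ring.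
have pE i : p`_i = 0 by rewrite p0 coef0.
split; first by have := pE 6; rewrite coef_Poly /= => /eqP; rewrite oppr_eq0 => /eqP.
by have := pE 4; rewrite coef_Poly.
Qed.

Section Tangency.
Variables (R : realType) (m k : nat) (A : 'I_k -> 'M[R[i]]_m).
Hypothesis hermA : forall j, A j \is hermsymmx.
Local Notation C := R[i].
Local Notation F := (hform A).
Local Notation cvc := (map_mx Num.conj).
Local Notation rv := (map_mx (real_complex R)).
Implicit Types (x y z p q h : 'cV[C]_m) (v w : 'cV[C]_k) (u : 'cV[R]_k).

Lemma polyfun_eval_at n (q : 'cV[mpoly (m + k) C]_n) (x : C -> 'cV[C]_m)
    (w : C -> 'cV[C]_k) l :
  (forall i, polyfun (fun s => x s i 0)) -> (forall j, polyfun (fun s => w s j 0)) ->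
  polyfun (fun s => eval_at (x s) (w s) q l 0).
Proof.
move=> px pw; apply: (@polyfun_eq _ (fun s => meval (fun i => col_mx (x s) (w s) i 0) (q l 0))).
  by move=> s; rewrite mxE.
apply: (@polyfun_meval _ _ (q l 0) (fun s i => col_mx (x s) (w s) i 0)) => i.
case: (split_ordP i) => j ->.
  by apply: polyfun_eq (px j) => s; rewrite col_mxEu.
by apply: polyfun_eq (pw j) => s; rewrite col_mxEd.
Qed.

Lemma polyfun_line n (p q : 'cV[C]_n) i : polyfun (fun s => (p + s *: q) i 0).
Proof.
apply: (@polyfun_eq _ (fun s => p i 0 + s * q i 0)); first by move=> s; rewrite !mxE.
by apply: polyfunD (polyfun_cst _) _; apply: polyfunM (polyfun_id _) (polyfun_cst _).
Qed.

Lemma polyfun_hforml (x : C -> 'cV[C]_m) p q j :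
  (forall i, polyfun (fun s => x s i 0)) ->
  polyfun (fun s => F (x s) (p + s^* *: q) j 0).
Proof.
move=> px; apply: (@polyfun_eq _ (fun s =>
    \sum_l (\sum_i A j l i * x s i 0) * ((p + s^* *: q) l 0)^*)).
  by move=> s; rewrite mxE /inner; apply: eq_bigr => l _; rewrite [in RHS]mxE.
apply: polyfun_sum => l; apply: polyfunM.
  by apply: polyfun_sum => i; apply: polyfunM (polyfun_cst _) (px i).
exact: polyfun_conj (polyfun_line p q l).
Qed.

Section Field.
Variables (f : 'cV[mpoly (m + k) C]_m) (g : 'cV[mpoly (m + k) C]_k).
Hypothesis tan : tangent A (f, g).

(* Polarised form of the point w = u + i F(z, z) of the quadric, and of the
   expression that tangency declares real. *)
Let wpol u x y := rv u + 'i *: F x y.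
Let E u j x y := (eval_at x (wpol u x y) g
  - (2 * 'i) *: F (eval_at x (wpol u x y) f) y) j 0.

(** At x = y this is the tangency condition, and both sides are holomorphic in x
    and antiholomorphic in y. *)
Lemma tangent_polar u j x y : E u j x y = (E u j y x)^*.
Proof.
apply/eqP; rewrite -subr_eq0; apply/eqP.
have pE p q : polyfun (fun s => E u j (p + s *: q) (p + s^* *: q)).
  have pw i : polyfun (fun s => wpol u (p + s *: q) (p + s^* *: q) i 0).
    apply: (@polyfun_eq _ (fun s => rv u i 0 + 'i * F (p + s *: q) (p + s^* *: q) i 0)).
      by move=> s; rewrite /wpol [RHS]mxE; congr (_ + _); rewrite [RHS]mxE.
    apply: polyfunD (polyfun_cst _) _; apply: polyfunM (polyfun_cst _) _.
    exact: polyfun_hform.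
  apply: (@polyfun_eq _ (fun s =>
      eval_at (p + s *: q) (wpol u (p + s *: q) (p + s^* *: q)) g j 0 -
      (2 * 'i) * F (eval_at (p + s *: q) (wpol u (p + s *: q) (p + s^* *: q)) f)
        (p + s^* *: q) j 0)).
    by move=> s; rewrite /E [RHS]mxE; congr (_ + _); rewrite [RHS]mxE; congr (- _); rewrite [RHS]mxE.
  apply: polyfunD; first by apply: polyfun_eval_at (polyfun_line _ _) pw.
  apply: polyfunN; apply: polyfunM (polyfun_cst _) _; apply: polyfun_hforml => i.
  exact: polyfun_eval_at (polyfun_line _ _) pw.
apply: (polarize_antihol (P := fun x y => E u j x y - (E u j y x)^*)) => [p q|z].
  apply: polyfunD (pE p q) (polyfunN _).
  by apply: polyfun_eq (polyfun_conj (pE p q)) => s; rewrite conjCK.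
apply/eqP; rewrite subr_eq0 eq_sym; apply/eqP/CrealP/Creal_ImP.
exact: (tan z u j).
Qed.

(* Automatic for g of weight 5, which is odd: every monomial contains some z_l. *)
Hypothesis g0 : forall w, eval_at 0 w g = 0.

(** The case y = 0 of [tangent_polar]. *)
Lemma tangent_g_real x u :
  eval_at x (rv u) g = (2 * 'i) *: F x (eval_at 0 (rv u) f).
Proof.
apply/colP => j; have := tangent_polar u j x 0.
rewrite /E /wpol hform0l !hform0r scaler0 addr0 scaler0 subr0 g0 sub0r => ->.
rewrite (hform_conj hermA _ x); move: (F _ _) => v; rewrite !mxE.
by rewrite rmorphN !rmorphM /= conjCi conjC_nat; ring.
Qed.

Lemma rv_conj u : cvc (rv u) = rv u.
Proof. by apply/colP => i; rewrite !mxE; apply: CrealP; rewrite complex_real. Qed.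

Lemma cV_re_im w : exists u1 u2, w = rv u1 + 'i *: rv u2.
Proof.
exists (map_mx (@complex.Re R) w), (map_mx (@complex.Im R) w).
by apply/colP => j; rewrite !mxE {1}[w j 0]complexE complexiE.
Qed.

(** Both sides are holomorphic in w and agree for real w. *)
Lemma tangent_g x w :
  eval_at x w g = (2 * 'i) *: F x (eval_at 0 (cvc w) f).
Proof.
have [u1 [u2 ->]] := cV_re_im w; apply/colP => j.
have cvcE s : cvc (rv u1 + s *: rv u2) = rv u1 + s^* *: rv u2.
  by rewrite map_mxD map_mxZ /= !rv_conj.
apply/eqP; rewrite -subr_eq0; apply/eqP.
pose H s := eval_at x (rv u1 + s *: rv u2) g j 0 -
   ((2 * 'i) *: F x (eval_at 0 (rv u1 + s^* *: rv u2) f)) j 0.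
rewrite cvcE; apply: (@polyfun_eq0_real _ H) => [|s sR].
  apply: polyfunD; first by apply: polyfun_eval_at (polyfun_line _ _) => i; exact: polyfun_cst.
  apply: polyfunN.
  pose K s := F (eval_at 0 (rv u1 + s *: rv u2) f) (x + s^* *: 0) j 0.
  apply: (@polyfun_eq _ (fun s => 2 * 'i * (K s^*)^*)).
    by move=> s; rewrite /K scaler0 addr0 [RHS]mxE (hform_conj hermA _ x) [in RHS]mxE.
  apply: polyfunM (polyfun_cst _) _; apply: polyfun_conj; apply: polyfun_hforml => i.
  by apply: polyfun_eval_at (polyfun_line _ _) => l; exact: polyfun_cst.
have sE : rv u1 + s *: rv u2 = rv (u1 + complex.Re s *: u2).
  by rewrite map_mxD map_mxZ /= RRe_real.
by rewrite /H (CrealP sR) sE tangent_g_real subrr.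
Qed.

(** [tangent_polar] after eliminating g by [tangent_g]. *)
Lemma tangent_f x y u :
  F x (eval_at 0 (rv u - 'i *: F y x) f) - F (eval_at x (rv u + 'i *: F x y) f) y =
  F x (eval_at y (rv u + 'i *: F y x) f) - F (eval_at 0 (rv u - 'i *: F x y) f) y.
Proof.
have alg (z1 z2 z3 z4 : 'cV[C]_m) j :
    ((2 * 'i) *: F x z1 - (2 * 'i) *: F z2 y) j 0 =
    (((2 * 'i) *: F y z3 - (2 * 'i) *: F z4 x) j 0)^* ->
    (F x z1 - F z2 y) j 0 = (F x z4 - F z3 y) j 0.
  rewrite (hform_conj hermA z3 y) (hform_conj hermA x z4).
  move: (F x z1) (F z2 y) (F z3 y) (F x z4) => v1 v2 v3 v4; rewrite !mxE.
  rewrite rmorphB !rmorphM /= !conjCK conjCi conjC_nat => e.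
  apply: (mulfI (_ : 2 * 'i != 0 :> C)); first by rewrite mulf_neq0 ?neq0Ci ?pnatr_eq0.
  by rewrite mulrBr e; ring.
have cE x' y' : cvc (wpol u x' y') = rv u - 'i *: F y' x'.
  by rewrite /wpol map_mxD map_mxZ /= conjCi scaleNr rv_conj -hform_conj.
apply/colP => j; have := tangent_polar u j x y.
rewrite /E (tangent_g x) (tangent_g y). rewrite (cE x y) (cE y x); exact: alg.
Qed.

Variables (a : 'cV[C]_m -> 'cV[C]_m) (b : 'cV[C]_m -> 'M[C]_(m, k)).
Variable c : 'cV[C]_k -> 'M[C]_(m, k).
Hypothesis aZ : forall t x, a (t *: x) = t ^+ 4 *: a x.
Hypothesis bZ : forall t x, b (t *: x) = t ^+ 2 *: b x.
Hypothesis csym : forall v w, c v *m w = c w *m v.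
Hypothesis fE : forall x w, eval_at x w f = a x + b x *m w + c w *m w.

Lemma eval_at0_f w : eval_at 0 w f = c w *m w.
Proof.
rewrite fE -(scale0r (0 : 'cV_m)) aZ bZ !expr0n !scale0r mul0mx.
by rewrite !add0r.
Qed.

Lemma sym_square v w :
  c (v - w) *m (v - w) - c (v + w) *m (v + w) = - (4 *: (c v *m w)).
Proof.
rewrite !mulmxDr !(csym (_ + _)) !mulmxDr !mulmxN !(csym (- _)) !mulmxN (csym w v).
by move: (c v *m v) (c v *m w) (c w *m w) => d1 d2 d3; apply/colP => j; rewrite !mxE; ring.
Qed.

(** For real t the scaling (x, y) -> (t x, y / t) preserves F(x, y) and F(y, x),
    while the components of [tangent_f] pick up different powers of t. *)
Lemma tangent_scaled x y u (t : C) : t^* = t -> t != 0 ->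
  t ^+ 4 *: F x (c (rv u - 'i *: F y x) *m (rv u - 'i *: F y x))
  - (t ^+ 6 *: F (a x) y + t ^+ 4 *: F (b x *m (rv u + 'i *: F x y)) y
     + t ^+ 2 *: F (c (rv u + 'i *: F x y) *m (rv u + 'i *: F x y)) y) =
  F x (a y) + t ^+ 2 *: F x (b y *m (rv u + 'i *: F y x))
     + t ^+ 4 *: F x (c (rv u + 'i *: F y x) *m (rv u + 'i *: F y x))
  - t ^+ 2 *: F (c (rv u - 'i *: F x y) *m (rv u - 'i *: F x y)) y.
Proof.
move=> tR tN0; have tVR : (t^-1)^* = t^-1 by rewrite fmorphV /= tR.
have Fxy : F (t *: x) (t^-1 *: y) = F x y.
  by rewrite hformZl hformZr tVR scalerA divff ?scale1r.
have Fyx : F (t^-1 *: y) (t *: x) = F y x.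
  by rewrite hformZl hformZr tR scalerA mulVf ?scale1r.
have := tangent_f (t *: x) (t^-1 *: y) u.
rewrite !eval_at0_f !fE Fxy Fyx !aZ !bZ -!scalemxAl.
rewrite !(hformDl, hformDr) !(hformZl, hformZr) !rmorphXn /= !tVR.
exact: (@clear_inverse_powers C k t _ _ _ _ _ _ _ _ tN0).
Qed.

(** The coefficients of t^6 and t^4 in [tangent_scaled]. *)
Lemma tangent_components x y u :
  F (a x) y = 0 /\
  F (b x *m (rv u + 'i *: F x y)) y = (4 * 'i) *: F x (c (rv u) *m F y x).
Proof.
have [E1 E2] : F (a x) y = 0 /\
  F (b x *m (rv u + 'i *: F x y)) y =
    F x (c (rv u - 'i *: F y x) *m (rv u - 'i *: F y x)) -
    F x (c (rv u + 'i *: F y x) *m (rv u + 'i *: F y x)); last first.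
  split=> //; rewrite E2 -hformNr -hformDr sym_square -scalemxAr hformNr !hformZr.
  by rewrite conjC_nat conjCi scaleNr scalerN opprK scalerA.
have tN0 n : n.+1%:R != 0 :> C by rewrite pnatr_eq0.
exact: (scaled_coefficients (fun n => tangent_scaled x y u (conjC_nat C n.+1) (tN0 n))).
Qed.

Lemma tangent_a_eq0 : (forall x, F x x = 0 -> x = 0) -> forall x, a x = 0.
Proof.
by move=> posF x; apply: posF; have [] := tangent_components x (a x) 0.
Qed.

Lemma tangent_b_form x y : F (b x *m F x y) y = 0.
Proof.
have [_] := tangent_components x y 0; rewrite map_mx0 add0r csym mulmx0 hform0r scaler0.
rewrite -scalemxAr hformZl => /eqP; rewrite scaler_eq0 (negPf (neq0Ci C)).
by move=> /eqP.
Qed.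

(** The part of [tangent_components] that is linear in u, extended from real to
    complex vectors: the right-hand side is linear in w because conjugation
    occurs twice. *)
Lemma tangent_b_c x y w :
  F (b x *m w) y = (4 * 'i) *: F x (c (cvc w) *m F y x).
Proof.
have real u : F (b x *m rv u) y = (4 * 'i) *: F x (c (rv u) *m F y x).
  have [_ <-] := tangent_components x y u.
  by rewrite mulmxDr hformDl -scalemxAr hformZl tangent_b_form scaler0 addr0.
have [u1 [u2 ->]] := cV_re_im w.
rewrite mulmxDr -scalemxAr hformDl hformZl !real map_mxD map_mxZ /= !rv_conj.
move: (F y x) => z; rewrite (csym (_ + _) z) mulmxDr -scalemxAr !(csym z) hformDr hformZr conjCK.
rewrite scalerDr.
by rewrite !scalerA (mulrC 'i).
Qed.

End Field.

Lemma eval_at_eq0 n (q : 'cV[mpoly (m + k) C]_n) :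
  (forall x w, eval_at x w q = 0) -> q = 0.
Proof.
move=> q0; apply/colP => l; rewrite mxE; apply: meval_eq0 => v.
have := congr1 (fun r : 'cV_n => r l 0)
  (q0 (\col_i v (lshift k i)) (\col_j v (rshift m j))); rewrite !mxE => <-.
apply: meval_eq => i; case: (split_ordP i) => j ->.
  by rewrite col_mxEu mxE.
by rewrite col_mxEd mxE.
Qed.

Lemma gcomp0 d : gcomp A d (0, 0).
Proof.
have wh e : whomog e (0 : mpoly (m + k) C) by move=> mon; rewrite msupp0.
have ev0 n x w : eval_at x w (0 : 'cV[mpoly (m + k) C]_n) = 0.
  by apply/colP => i; rewrite !mxE meval0.
split=> [l|j|z u w j] /=; [by rewrite mxE; exact: wh..|].
by rewrite !ev0 hform0l scaler0 subr0 mxE; apply/Creal_ImP.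
Qed.

End Tangency.

Theorem proposition6p1 (R : realType) (m k : nat) (A : 'I_k -> 'M[R[i]]_m)
    (hermA : forall j, A j \is hermsymmx) (spcA : strongly_pseudoconvex A) :
  T_nondegenerate A /\ gcomp A 3 = [set 0].
Proof.
have [nondegA /positive_hform_eq0 posF] := spcA; have [frA _] := nondegA.
split.
  split=> //; exists setT; split=> [||a _]; [exact: openT| |exact: orthF_Tset].
  by move=> O O0 _; rewrite setIT.
apply/seteqP; split=> [[f g] /= [f4 g5 tan]|_ -> ]; last exact: gcomp0.
have g0 w : eval_at 0 w g = 0.
  by apply/colP => j; rewrite !mxE; apply: whomog5_at0; exact: g5.
have [a [b [c [aZ bZ csym fE]]]] := whomog4_mx f4.
have a0 := tangent_a_eq0 hermA tan g0 aZ bZ csym fE posF.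
have Fb := tangent_b_form hermA tan g0 aZ bZ csym fE.
have Fbc := tangent_b_c hermA tan g0 aZ bZ csym fE.
have b0 := quadratic_coefficient_eq0 hermA posF frA csym Fb Fbc.
have c0 := bilinear_coefficient_eq0 hermA posF frA csym Fb Fbc.
have f0 x w : eval_at x w f = 0 by rewrite fE a0 b0 c0 mul0mx !addr0.
congr (_, _); apply: eval_at_eq0 => x w //.
by rewrite (tangent_g hermA tan g0) f0 hform0r scaler0.
Qed.
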